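(* Let $\varphi\in[0,2\pi)$, $\theta\in(-\frac\pi2,0)\cup(0,\frac\pi2)$, $a,b\in\mathbb{C}$ with $b\neq0$, $k,m\in\mathbb{R}$, and $$L=T_\theta\begin{pmatrix} a&b&0&0\\ e^{2ik}\bar b&a+me^{ik}&0&0\\ 0&0&a&e^{-2i\theta}b\\ 0&0&e^{2i\theta}e^{2ik}\bar b&a+me^{ik}\end{pmatrix}T_\theta^\dagger,\qquad T_\theta=\begin{pmatrix}1&0&0&0\\ 0&ie^{-i\varphi}\sin\theta&\cos\theta&0\\ 0&-\cos\theta&-ie^{i\varphi}\sin\theta&0\\ 0&0&0&1\end{pmatrix}.$$ Then the attractor space of the semigroup generated by $L$ and $H$ is four-dimensional with orthonormal (Hilbert–Schmidt) basis $$X_1=\tfrac12 I,\qquad X_2=\frac12\begin{pmatrix}1&0&0&0\\ 0&-\cos2\theta&-ie^{-i\varphi}\sin2\theta&0\\ 0&ie^{i\varphi}\sin2\theta&\cos2\theta&0\\ 0&0&0&-1\end{pmatrix},$$ $$X_3=\frac{\cos\theta}{\sqrt2}\begin{pmatrix}0&e^{i\theta}&ie^{-i\varphi}\tan\theta\,e^{i\theta}&0\\ 0&0&0&ie^{-i\varphi}\tan\theta\,e^{-i\theta}\\ 0&0&0&-e^{-i\theta}\\ 0&0&0&0\end{pmatrix},\qquad X_4=X_3^\dagger,$$ which are eigenvectors of $\mathcal L$ with eigenvalues $0,0,-i\Delta E,i\Delta E$ respectively.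
   Context: Hilbert space $\mathbb{C}^2\otimes\mathbb{C}^2$, $|ij\rangle=|i\rangle\otimes|j\rangle$; matrices are in the ordered basis $(|00\rangle,|01\rangle,|10\rangle,|11\rangle)$. $H=H_0\otimes I+I\otimes H_0$ with $H_0=\mathrm{diag}(E_0,E_1)$, $E_0,E_1\in\mathbb{R}$, $\Delta E=E_0-E_1\neq0$. The generator is $\mathcal L(\rho)=-i[H,\rho]+L\rho L^\dagger-\frac12\{L^\dagger L,\rho\}$. The attractor space is the direct sum of $\ker(\mathcal L-\lambda I)$ over all purely imaginary eigenvalues $\lambda$ (including $0$) of $\mathcal L$. *)

(* Defs.v *)
From HB Require Import structures.
From mathcomp Require Import all_boot all_order all_algebra.
From mathcomp Require Import sesquilinear spectral.
From mathcomp Require Import complex mxtens.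
From mathcomp Require Import reals trigo.
From mathcomp Require Import ring.

Set Implicit Arguments.
Unset Strict Implicit.
Unset Printing Implicit Defensive.

Import Order.TTheory GRing.Theory Num.Theory.

Local Open Scope ring_scope.
Local Open Scope sesquilinear_scope.

Section Spectrum.
Variables (C : closedFieldType) (V : vectType C).
Implicit Type f : 'End(V).

(* The eigenvalues of f, listed without repetition (see mem_spectrum). *)
Definition spectrum f : seq C :=
  let A := passmx.mxof (vbasis {:V}) (vbasis {:V}) f in
  undup (sval (closed_field_poly_normal (char_poly A))).

Lemma mem_leigenspace f (a : C) (v : V) :
  (v \in passmx.leigenspace f a) = (f v == a *: v).
Proof.
by rewrite memv_ker add_lfunE opp_lfunE scale_lfunE id_lfunE subr_eq0.
Qed.

Lemma mem_spectrum f (a : C) : (a \in spectrum f) = passmx.leigenvalue f a.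
Proof.
rewrite /passmx.leigenvalue (passmx.leigenspaceE (vbasisP fullv)).
rewrite passmx.vsof_eq0 ?vbasisP //.
set A := passmx.mxof _ _ f.
rewrite -[RHS]/(eigenvalue A a) eigenvalue_root_char /spectrum -/A mem_undup.
case: closed_field_poly_normal => r /= Dp.
by rewrite Dp (monicP (char_poly_monic A)) scale1r root_prod_XsubC.
Qed.

Lemma directv_leigenspace f (P : pred (seq_sub (spectrum f))) :
  directv (\sum_(a | P a) passmx.leigenspace f (ssval a)).
Proof.
have [m] := ubnP #|P|; elim: m P => // m IHm P lePm.
apply/directv_sumP => i Pi; apply/eqP; rewrite -subv0; apply/subvP => v.
rewrite memv_cap memv0 mem_leigenspace => /andP[/eqP fv].
pose P' j := P j && (j != i).
have dx : directv (\sum_(a | P' a) passmx.leigenspace f (ssval a)).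
  by apply: IHm; rewrite (cardD1x Pi) in lePm.
case/memv_sumP => u Uu Dv.
have Efu j : P' j -> f (u j) = ssval j *: u j.
  by move=> P'j; apply/eqP; rewrite -mem_leigenspace Uu.
have E0 : \sum_(j | P' j) (ssval j - ssval i) *: u j = 0.
  under eq_bigr => j P'j do rewrite scalerBl -Efu //.
  by rewrite sumrB -linear_sum -scaler_sumr /= -Dv fv subrr.
rewrite Dv big1 // => j P'j.
have /(_ j P'j)/eqP := directv_sum_independent dx _
  (fun j P'j => memvZ (ssval j - ssval i) (Uu j P'j)) E0.
rewrite scaler_eq0 subr_eq0 => /orP[/eqP/val_inj ji|/eqP //].
by move: P'j; rewrite /P' ji eqxx andbF.
Qed.
End Spectrum.

(* The sum is direct by directv_leigenspace; 0 counts as purely imaginary. *)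
Definition attractor_space (C : numClosedFieldType) (V : vectType C)
    (f : 'End(V)) : {vspace V} :=
  (\sum_(a : seq_sub (spectrum f) | 'Re (ssval a) == 0%R)
     passmx.leigenspace f (ssval a))%VS.

Section Lindblad.
Variables (C : numClosedFieldType) (n : nat).
Implicit Types H L X Y rho : 'M[C]_n.

Definition commutator X Y := X *m Y - Y *m X.
Definition anticommutator X Y := X *m Y + Y *m X.

Definition lindblad H L rho : 'M[C]_n :=
  - 'i *: commutator H rho + L *m rho *m L^t*
  - 2^-1 *: anticommutator (L^t* *m L) rho.

Fact lindblad_is_linear H L : linear (lindblad H L).
Proof.
move=> a X Y; rewrite /lindblad /commutator /anticommutator.
rewrite !(mulmxDr, mulmxDl) -!(scalemxAr, scalemxAl).
move: (H *m X) (H *m Y) (X *m H) (Y *m H) => A1 A2 A3 A4.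
move: (L *m X *m _) (L *m Y *m _) (_ *m L *m X) (_ *m L *m Y).
move: (X *m (_ *m L)) (Y *m (_ *m L)) => B1 B2 B3 B4 B5 B6.
by apply/matrixP => i j; rewrite !mxE; ring.
Qed.
HB.instance Definition _ H L :=
  GRing.isLinear.Build C 'M[C]_n 'M[C]_n *:%R (lindblad H L)
    (lindblad_is_linear H L).

Definition generator H L : 'End('M[C]_n) := linfun (lindblad H L).

Definition hsdot X Y : C := \tr (X^t* *m Y).

Definition eigenvector_of (f : 'End('M[C]_n)) (a : C) X :=
  X != 0 /\ f X = a *: X.
End Lindblad.

Section TwoQubits.
Variable R : realType.
Local Notation C := R[i].
Local Open Scope complex_scope.
Implicit Types (a b : C) (phi theta k m x : R).

Definition expi x : C := cos x +i* sin x.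

Definition mx_of_rows n (rows : seq (seq C)) : 'M[C]_n :=
  \matrix_(i, j) nth 0 (nth [::] rows i) j.

Definition H0 (E0 E1 : R) : 'M[C]_2 :=
  mx_of_rows 2 [:: [:: E0%:C; 0]; [:: 0; E1%:C]].

(* mxtens orders the basis lexicographically: |ij> has index 2 * i + j *)
Definition Hamiltonian (E0 E1 : R) : 'M[C]_4 :=
  H0 E0 E1 *t 1%:M + 1%:M *t H0 E0 E1.

Definition Tmx phi theta : 'M[C]_4 :=
  let s := (sin theta)%:C in let c := (cos theta)%:C in
  mx_of_rows 4
    [:: [:: 1; 0; 0; 0];
        [:: 0; 'i%R * expi (- phi) * s; c; 0];
        [:: 0; - c; - ('i%R * expi phi * s); 0];
        [:: 0; 0; 0; 1]].

Definition Lmx phi theta a b k m : 'M[C]_4 :=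
  let d := a + m%:C * expi k in
  let b' := expi (2 * k) * (b^*)%R in
  Tmx phi theta *m
  mx_of_rows 4
    [:: [:: a; b; 0; 0];
        [:: b'; d; 0; 0];
        [:: 0; 0; a; expi (- (2 * theta)) * b];
        [:: 0; 0; expi (2 * theta) * b'; d]]
  *m (Tmx phi theta)^t*.

Definition X1 : 'M[C]_4 := 2^-1 *: 1%:M.

Definition X2 phi theta : 'M[C]_4 :=
  let s2 := (sin (2 * theta))%:C in let c2 := (cos (2 * theta))%:C in
  2^-1 *: mx_of_rows 4
    [:: [:: 1; 0; 0; 0];
        [:: 0; - c2; - ('i%R * expi (- phi) * s2); 0];
        [:: 0; 'i%R * expi phi * s2; c2; 0];
        [:: 0; 0; 0; -1]].

Definition X3 phi theta : 'M[C]_4 :=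
  let t := 'i%R * expi (- phi) * (tan theta)%:C in
  (cos theta / Num.sqrt 2)%:C *: mx_of_rows 4
    [:: [:: 0; expi theta; t * expi theta; 0];
        [:: 0; 0; 0; t * expi (- theta)];
        [:: 0; 0; 0; - expi (- theta)];
        [:: 0; 0; 0; 0]].

Definition X4 phi theta : 'M[C]_4 := (X3 phi theta)^t*.
End TwoQubits.

(* Main.v *)
(** The jump operator is [L = T M T^*] with [T] unitary and [M] a direct sum of
    two unitarily equivalent blocks [a I + e^(ik) K], [K] Hermitian, so that [L]
    is normal.  For normal [L] the rate of change of the Hilbert-Schmidt norm is
    [2 Re <X, Lindblad X> = - |[L, X]|^2]; hence an eigenvector [X] for a purely
    imaginary eigenvalue commutes with [L] and, by normality, with [L^*].  The
    dissipator vanishes on such an [X], which is therefore an eigenvector of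
    [-i [H, .]].  Since [T] commutes with [H], all this can be read in the basis
    of the columns of [T]: [H] is diagonal there, its level differences decide
    which entries survive, and commutation with [M] leaves four dimensions. *)

Require Import Defs.
From mathcomp Require Import all_boot all_order all_algebra.
From mathcomp Require Import sesquilinear spectral.
From mathcomp Require Import complex reals trigo ring.

Set Implicit Arguments.
Unset Strict Implicit.
Unset Printing Implicit Defensive.

Import Order.TTheory GRing.Theory Num.Theory.
Local Open Scope ring_scope.

(** * Hilbert-Schmidt geometry of Lindblad generators with a normal jump operator *)

Section NormalLindblad.
Variables (C : numClosedFieldType) (n : nat).
Implicit Types H L T X Y : 'M[C]_n.
Local Open Scope sesquilinear_scope.

Lemma adjmxM X Y : (X *m Y)^t* = Y^t* *m X^t*.
Proof. by rewrite trmx_mul map_mxM. Qed.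

Lemma adjmxB X Y : (X - Y)^t* = X^t* - Y^t*.
Proof. by rewrite linearB /= map_mxB. Qed.

Lemma mxtraceN X : \tr (- X) = - \tr X.
Proof. exact: raddfN. Qed.

Lemma mxtraceB X Y : \tr (X - Y) = \tr X - \tr Y.
Proof. exact: raddfB. Qed.

Lemma conj_hsdot X Y : (hsdot X Y)^* = hsdot Y X.
Proof.
rewrite /hsdot -[in RHS](trmxCK X) -adjmxM.
by rewrite trace_map_mx mxtrace_tr.
Qed.

Lemma hsdot_eq0 X : hsdot X X = 0 -> X = 0.
Proof.
have -> : hsdot X X = \sum_i \sum_j `|X j i| ^+ 2.
  apply: eq_bigr => i _; rewrite mxE; apply: eq_bigr => j _.
  by rewrite !mxE normCKC.
move=> X0; apply/matrixP => j i; rewrite mxE.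
have ge0 i' j' : 0 <= `|X j' i'| ^+ 2 by apply: exprn_ge0.
have {}X0 : \sum_j0 `|X j0 i| ^+ 2 = 0.
  by apply: (psumr_eq0P _ X0) => // i' _; apply: sumr_ge0.
have /eqP : `|X j i| ^+ 2 = 0 by apply: (psumr_eq0P _ X0).
by rewrite expf_eq0 normr_eq0 /= => /eqP.
Qed.

Lemma hsdot_sumr X I (r : seq I) (c : I -> C) (Y : I -> 'M[C]_n) :
  hsdot X (\sum_(i <- r) c i *: Y i) = \sum_(i <- r) c i * hsdot X (Y i).
Proof.
rewrite /hsdot mulmx_sumr raddf_sum; apply: eq_bigr => i _.
by rewrite -scalemxAr /= mxtraceZ.
Qed.

Lemma hsdot_free (X : seq 'M[C]_n) :
  (forall i j : 'I_(size X), hsdot X`_i X`_j = (i == j)%:R) -> free X.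
Proof.
move=> oX; suff: free (in_tuple X) by []; apply/freeP => c c0 i.
have := hsdot_sumr X`_i (index_enum 'I_(size X)) c (fun j => X`_j).
rewrite c0 /hsdot mulmx0 mxtrace0 (bigD1 i) //= big1 => [|j ji].
  by have:= oX i i; rewrite /hsdot => ->; rewrite eqxx mulr1 addr0.
by have:= oX i j; rewrite /hsdot => ->; rewrite eq_sym (negPf ji) mulr0.
Qed.

Lemma hsdot_unitary T X Y : T^t* *m T = 1%:M ->
  hsdot (T *m X *m T^t*) (T *m Y *m T^t*) = hsdot X Y.
Proof.
move=> TT; rewrite /hsdot !adjmxM trmxCK -!mulmxA mxtrace_mulC.
by rewrite -!mulmxA TT mulmx1 (mulmxA (T^t* )) TT mul1mx.
Qed.

(** Conjugation by a unitary preserves products, adjoints and linear combinations, and the Lindblad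
    expression is built from these alone. *)
Lemma lindblad_unitary T H L X : T^t* *m T = 1%:M ->
  lindblad (T *m H *m T^t*) (T *m L *m T^t*) (T *m X *m T^t*)
  = T *m lindblad H L X *m T^t*.
Proof.
move=> TT; rewrite /lindblad /commutator /anticommutator.
have mulT A B : (T *m A *m T^t*) *m (T *m B *m T^t*) = T *m (A *m B) *m T^t*.
  by rewrite -!mulmxA (mulmxA (T^t* ) T) TT mul1mx.
have adjT A : (T *m A *m T^t*)^t* = T *m A^t* *m T^t*.
  by rewrite !adjmxM trmxCK mulmxA.
rewrite adjT !mulT mulmxBr mulmxDr mulmxBl mulmxDl -!scalemxAr -!scalemxAl.
by rewrite mulmxBr mulmxBl mulmxDr mulmxDl.
Qed.

(** Cyclicity of the trace lets all four words start with [X^t*]; this is the normal form in which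
    traces are compared below. *)
Lemma hsdot_commutator L X : hsdot (commutator L X) (commutator L X)
  = \tr (X^t* *m L^t* *m L *m X) - \tr (X^t* *m L^t* *m X *m L)
    - \tr (X^t* *m L *m X *m L^t*) + \tr (X^t* *m X *m L *m L^t*).
Proof.
rewrite /hsdot /commutator adjmxB !adjmxM mulmxBl !mulmxBr.
rewrite !mxtraceB !mulmxA -!(mulmxA (L^t* )) ![\tr (L^t* *m _)]mxtrace_mulC.
by rewrite opprB addrA addrAC.
Qed.

(* Fuglede's theorem for a normal L in quantitative form. *)
Lemma hsdot_commutator_adj L X : L \is normalmx ->
  hsdot (commutator (L^t* ) X) (commutator (L^t* ) X)
  = hsdot (commutator L X) (commutator L X).
Proof.
(* Exchanging [L] with its adjoint swaps the two middle traces, and normality identifies each outer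
   trace with its counterpart. *)
move=> /normalmxP nL; rewrite !hsdot_commutator !trmxCK.
rewrite -(mulmxA (X^t* ) L (L^t* )) -(mulmxA (X^t* ) (L^t* ) L).
by rewrite -!(mulmxA (X^t* *m X)) nL; ring.
Qed.

(** The Hamiltonian part is [- 'i] times a real number, so it cancels against its conjugate. The
    jump trace and its conjugate are the two mixed terms of [hsdot_commutator]; the anticommutator
    supplies the outer two, the last one after normality trades [L^t* *m L] for [L *m L^t*]. *)
Lemma hsdot_lindblad H L X : H^t* = H -> L \is normalmx ->
  hsdot X (lindblad H L X) + (hsdot X (lindblad H L X))^*
  = - hsdot (commutator L X) (commutator L X).
Proof.
move=> hH /normalmxP nL.
have hM : (L^t* *m L)^t* = L^t* *m L by rewrite adjmxM trmxCK.
have herm A : A^t* = A -> (\tr (X^t* *m A *m X))^* = \tr (X^t* *m A *m X).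
  move=> hA; have := conj_hsdot X (A *m X).
  by rewrite /hsdot adjmxM hA !mulmxA.
have herm' A : A^t* = A -> (\tr (X^t* *m X *m A))^* = \tr (X^t* *m X *m A).
  move=> hA; have := conj_hsdot X (X *m A).
  rewrite /hsdot adjmxM hA !mulmxA => ->.
  by rewrite -mulmxA mxtrace_mulC.
have jump : (\tr (X^t* *m L *m X *m L^t*))^* = \tr (X^t* *m L^t* *m X *m L).
  have := conj_hsdot X (L *m X *m L^t*).
  rewrite /hsdot !adjmxM trmxCK !mulmxA => ->.
  by rewrite -!mulmxA mxtrace_mulC !mulmxA.
rewrite hsdot_commutator /hsdot /lindblad /commutator /anticommutator.
rewrite mulmxBr mulmxDr -!scalemxAr mulmxBr mulmxDr !mulmxA.
rewrite !(mxtraceD, mxtraceN, mxtraceZ) !(rmorphB, rmorphD, rmorphM, rmorphN) /=.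
rewrite -!(mulmxA (X^t* ) (L^t* ) L) -(mulmxA (X^t* *m X) L (L^t* )) nL.
rewrite -(mulmxA (X^t* *m X) (L^t* ) L).
rewrite (herm H) // (herm' H) // (herm _ hM) (herm' _ hM) jump.
rewrite conjCi fmorphV rmorph_nat.
move: (\tr _) (\tr _) => p q; move: (\tr _) (\tr _) => r s.
by move: (\tr _) (\tr _) => x y; field.
Qed.

(** For an eigenvector the left side of [hsdot_lindblad] is [hsdot X X] times [a + a^*], which is
    zero for imaginary [a]; hence the squared norm of the commutator vanishes. *)
Lemma commutator_lindblad H L X a : H^t* = H -> L \is normalmx ->
  'Re a = 0 -> lindblad H L X = a *: X -> commutator L X = 0.
Proof.
move=> hH nL /eqP ra eX; apply: hsdot_eq0; apply: oppr_inj.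
rewrite oppr0 -(hsdot_lindblad _ hH nL) eX.
have -> : hsdot X (a *: X) = a * hsdot X X by rewrite /hsdot -scalemxAr mxtraceZ.
rewrite rmorphM /= conj_hsdot -mulrDl.
move: ra; rewrite ReE mulf_eq0 invr_eq0 pnatr_eq0 orbF => /eqP ->.
by rewrite mul0r.
Qed.

Lemma lindblad_commute H L X : L \is normalmx -> commutator L X = 0 ->
  lindblad H L X = - 'i *: commutator H X.
Proof.
move=> nL cLX; have := hsdot_commutator_adj X nL.
rewrite cLX {2}/hsdot mulmx0 mxtrace0 => /hsdot_eq0 /eqP.
rewrite subr_eq0 => /eqP cL'; move: cLX => /eqP; rewrite subr_eq0 => /eqP cLX.
rewrite /lindblad /anticommutator cLX -(mulmxA (L^t* )) cLX (mulmxA (L^t* )).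
rewrite cL' -!mulmxA (normalmxP nL) -addrA.
(* The jump term and both halves of the anticommutator have become the same matrix. *)
move: (X *m _) => A; rewrite -mulr2n -scaler_nat scalerA mulVf ?pnatr_eq0 //.
by rewrite scale1r subrr addr0.
Qed.

Lemma mulmx_span T (U : 'M[C]_n) (Y : seq 'M[C]_n) Z :
  Z \in <<Y>>%VS -> T *m Z *m U \in <<[seq T *m A *m U | A <- Y]>>%VS.
Proof.
move/(coord_span (X := in_tuple Y)) => ->; rewrite mulmx_sumr mulmx_suml.
apply: memv_suml => i _; rewrite -scalemxAr -scalemxAl memvZ // memv_span //.
by apply: (map_f (fun A => T *m A *m U)); apply: mem_nth.
Qed.

Local Open Scope complex_scope.
Local Open Scope sesquilinear_scope.

(** This reduces the eigenvector claims of the theorem to pairs of commutator identities free of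
    [T]; [unitary_frame_commutator] is the way back. *)
Lemma unitary_frame_eigenvector T H L Y (w : C) :
  T^t* *m T = 1%:M -> T *m H *m T^t* = H -> L \is normalmx ->
  commutator L Y = 0 -> commutator H Y = w *: Y ->
  generator H (T *m L *m T^t*) (T *m Y *m T^t*) = (- 'i * w) *: (T *m Y *m T^t*).
Proof.
move=> TT TH nL cL cH; rewrite lfunE /= -{1}TH lindblad_unitary //.
rewrite lindblad_commute // cH scalerA.
by rewrite -scalemxAr -scalemxAl.
Qed.

Lemma unitary_frame_commutator T H L X (a : C) :
  T^t* *m T = 1%:M -> T *m H *m T^t* = H -> H^t* = H -> L \is normalmx ->
  'Re a = 0 -> generator H (T *m L *m T^t*) X = a *: X ->
  exists Y, [/\ X = T *m Y *m T^t*, commutator L Y = 0 & commutator H Y = ('i * a) *: Y].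
Proof.
move=> TT TH hH nL ra; have TT' := mulmx1C TT.
have -> : X = T *m (T^t* *m X *m T) *m T^t*.
  by rewrite !mulmxA TT' mul1mx -mulmxA TT' mulmx1.
move: (T^t* *m X *m T) => Y.
rewrite lfunE /= -{1}TH lindblad_unitary // scalemxAl scalemxAr.
move/(congr1 (fun Z => T^t* *m Z *m T)) => /=.
rewrite !mulmxA TT !mul1mx -!mulmxA TT !mulmx1 => eY.
have cL := commutator_lindblad hH nL ra eY.
exists Y; split=> //; first by rewrite mulmxA.
(* Multiplying [- 'i *: [H, Y] = a *: Y] by ['i] isolates the commutator. *)
move: eY; rewrite lindblad_commute // => /(congr1 ( *:%R 'i)).
by rewrite !scalerA mulrN -expr2 sqrCi opprK scale1r.
Qed.
End NormalLindblad.

(** * Membership in and upper bounds for the attractor space of an endomorphism *)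

Section AttractorSpace.
Variables (C : numClosedFieldType) (V : vectType C).
Implicit Types (f : 'End(V)) (a : C) (v : V) (U : {vspace V}).

Lemma memv_attractor f v a :
  'Re a = 0 -> f v = a *: v -> v \in attractor_space f.
Proof.
(* For [v = 0] the scalar [a] need not be an eigenvalue, so this case cannot go through the
   spectrum. *)
move=> ra fv; have [->|v0] := eqVneq v 0; first exact: mem0v.
have sa : a \in spectrum f.
  rewrite mem_spectrum; apply/eqP => e0; move: v0.
  by rewrite -memv0 -e0 mem_leigenspace fv eqxx.
have := @sumv_sup _ _ _ (SeqSub sa)
  (fun c : seq_sub (spectrum f) => 'Re (ssval c) == 0)
  (passmx.leigenspace f a) (fun c => passmx.leigenspace f (ssval c)).
rewrite /= ra eqxx subvv => /(_ isT isT) /subvP; apply.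
by rewrite mem_leigenspace fv.
Qed.

Lemma attractor_subv f U :
  (forall a v, 'Re a = 0 -> f v = a *: v -> v \in U) ->
  (attractor_space f <= U)%VS.
Proof.
move=> fU; apply/subv_sumP => a /eqP ra; apply/subvP => v.
by rewrite mem_leigenspace => /eqP; apply: fU.
Qed.

Lemma memv_span4 v1 v2 v3 v4 c1 c2 c3 c4 :
  c1 *: v1 + c2 *: v2 + c3 *: v3 + c4 *: v4 \in <<[:: v1; v2; v3; v4]>>%VS.
Proof. by rewrite !memvD ?memvZ ?memv_span // !inE eqxx ?orbT. Qed.
End AttractorSpace.

(** * Phases and explicit matrices of the two-qubit model *)

Section TwoQubitModel.
Variable R : realType.
Local Notation C := R[i].
Implicit Types (x y phi theta k m : R) (a b : C) (r s : seq (seq C)).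
Local Open Scope sesquilinear_scope.

Lemma conjC_realC x : (x%:C%C)^* = x%:C%C.
Proof. exact: conjc_real. Qed.

Lemma expiN x : expi (- x) = (expi x)^*.
Proof. by rewrite /expi cosN sinN. Qed.

Lemma expiD x y : expi (x + y) = expi x * expi y.
Proof. by rewrite /expi cosD sinD addrC; congr (_ +i* _)%C; rewrite addrC. Qed.

Lemma expi_conjK x : expi x * (expi x)^* = 1.
Proof. by rewrite -expiN -expiD subrr /expi cos0 sin0. Qed.

Lemma expi_neq0 x : expi x != 0.
Proof.
by apply/eqP => e0; have /eqP := expi_conjK x; rewrite e0 mul0r eq_sym oner_eq0.
Qed.

Lemma expi2 x : expi (2 * x) = expi x ^+ 2.
Proof. by rewrite mulr_natl mulr2n expiD. Qed.

Lemma cos2C x : ((cos x)%:C ^+ 2 = 1 - (sin x)%:C ^+ 2)%C.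
Proof. by rewrite -!rmorphXn cos2sin2 rmorphB rmorph1. Qed.

Local Notation entry := (fun r i j => nth 0 (nth [::] r i) j).

(* Matrix operations are carried out on lists of rows, which [/=] evaluates entry by entry. *)
Definition rows_of n (f : nat -> nat -> C) := mkseq (fun i => mkseq (f i) n) n.

Lemma mx_of_rows_of n (f : nat -> nat -> C) :
  mx_of_rows n (rows_of n f) = \matrix_(i, j) f i j.
Proof. by apply/matrixP => i j; rewrite !mxE !nth_mkseq. Qed.

Lemma mx_of_rowsP n r s : mx_of_rows n r = mx_of_rows n s ->
  forall i j, (i < n)%N -> (j < n)%N -> entry r i j = entry s i j.
Proof.
move=> /matrixP rs i j lti ltj.
by have := rs (Ordinal lti) (Ordinal ltj); rewrite !mxE.
Qed.

Lemma mx_rows_of n (A : 'M[C]_n.+1) :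
  A = mx_of_rows n.+1 (rows_of n.+1 (fun i j => A (inord i) (inord j))).
Proof. by rewrite mx_of_rows_of; apply/matrixP => i j; rewrite mxE !inord_val. Qed.

Lemma scalar_mx_rows n a : a%:M = mx_of_rows n (rows_of n (fun i j => a *+ (i == j))).
Proof. by rewrite mx_of_rows_of; apply/matrixP => i j; rewrite !mxE. Qed.

Lemma add_mx_rows n r s : mx_of_rows n r + mx_of_rows n s
  = mx_of_rows n (rows_of n (fun i j => entry r i j + entry s i j)).
Proof. by rewrite mx_of_rows_of; apply/matrixP => i j; rewrite !mxE. Qed.

Lemma scale_mx_rows n a r : a *: mx_of_rows n r
  = mx_of_rows n (rows_of n (fun i j => a * entry r i j)).
Proof. by rewrite mx_of_rows_of; apply/matrixP => i j; rewrite !mxE. Qed.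

Lemma adj_mx_rows n r : (mx_of_rows n r)^t*
  = mx_of_rows n (rows_of n (fun i j => (entry r j i)^*)).
Proof. by rewrite mx_of_rows_of; apply/matrixP => i j; rewrite !mxE. Qed.

(** A [foldr] over [iota] unfolds by computation, unlike the locked big operator over ordinals. *)
Lemma sum_ord_foldr n (f : nat -> C) :
  \sum_(l < n) f l = foldr (fun l => +%R (f l)) 0 (iota 0 n).
Proof. by rewrite -(big_mkord xpredT) unlock /index_iota subn0. Qed.

Lemma mul_mx_rows n r s : mx_of_rows n r *m mx_of_rows n s
  = mx_of_rows n (rows_of n (fun i j =>
      foldr (fun l => +%R (entry r i l * entry s l j)) 0 (iota 0 n))).
Proof.
rewrite mx_of_rows_of; apply/matrixP => i j; rewrite !mxE -sum_ord_foldr.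
by apply: eq_bigr => k _; rewrite !mxE.
Qed.

Lemma trace_mx_rows n r : \tr (mx_of_rows n r)
  = foldr (fun l => +%R (entry r l l)) 0 (iota 0 n).
Proof. by rewrite -sum_ord_foldr; apply: eq_bigr => k _; rewrite mxE. Qed.

(** Conjugation is pushed to the atoms, and phases are reduced to [expi x] and its conjugate, so
    that entries become expressions on which [ring] can decide. *)
Ltac conj_simpl := rewrite ?expiN ?expi2; rewrite ?rmorph0 ?rmorph1; repeat
  progress rewrite ?(rmorphN, rmorphD, rmorphM, rmorphXn)
    ?(conjCK, conjC_realC, conjCi, fmorphV, rmorph_nat) /=.

Ltac mx_simpl :=
  rewrite ?scale_mx_rows /rows_of /mkseq /= ?mulr0 ?adj_mx_rows /rows_of /mkseq /=;
  conj_simpl; rewrite ?(mul_mx_rows, add_mx_rows, scale_mx_rows) /rows_of /mkseq /=;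
  rewrite ?(mulr0, mul0r, addr0, add0r, mulr1, mul1r).

Ltac congr_mx4 := congr (mx_of_rows 4
  [:: [:: _; _; _; _]; [:: _; _; _; _]; [:: _; _; _; _]; [:: _; _; _; _]]).

(** * The Hamiltonian and the change of basis *)

Lemma HamiltonianE (E0 E1 : R) : Hamiltonian E0 E1 = mx_of_rows 4
  [:: [:: 2 * E0%:C; 0; 0; 0]; [:: 0; E0%:C + E1%:C; 0; 0];
      [:: 0; 0; E0%:C + E1%:C; 0]; [:: 0; 0; 0; 2 * E1%:C]]%C.
Proof.
by apply/matrixP => - [[|[|[|[|//]]]] ?] [[|[|[|[|//]]]] ?]; rewrite !mxE /=; ring.
Qed.

Lemma Tmx_unitary phi theta : (Tmx phi theta)^t* *m Tmx phi theta = 1%:M.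
Proof.
rewrite /Tmx scalar_mx_rows; mx_simpl.
(* With the atoms generalized, [ring] works modulo the Pythagorean identity, the unit modulus of the
   phase and the square of ['i]. The same scheme recurs below with other relations. *)
move: (cos2C theta) (expi_conjK phi) (@sqrCi C).
move: (expi phi) (expi phi)^* (cos theta)%:C%C (sin theta)%:C%C 'i => p q c s j E1 E2 E3.
by congr_mx4; ring: E1 E2 E3.
Qed.

(** [Tmx] mixes only [|01>] and [|10>], which share the energy [E0 + E1], so it commutes with the
    Hamiltonian. *)
Lemma Tmx_Hamiltonian (E0 E1 : R) phi theta :
  Tmx phi theta *m Hamiltonian E0 E1 *m (Tmx phi theta)^t* = Hamiltonian E0 E1.
Proof.
suff -> : Tmx phi theta *m Hamiltonian E0 E1 = Hamiltonian E0 E1 *m Tmx phi theta.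
  by rewrite -mulmxA (mulmx1C (Tmx_unitary phi theta)) mulmx1.
by rewrite HamiltonianE /Tmx; mx_simpl; congr_mx4; ring.
Qed.

Lemma Hamiltonian_hermitian (E0 E1 : R) : (Hamiltonian E0 E1)^t* = Hamiltonian E0 E1.
Proof. by rewrite HamiltonianE; mx_simpl. Qed.

(* [frameL], [frameX2], [frameX3] are [Lmx], [X2], [X3] in the basis of the columns of [Tmx]. *)
Definition frameL theta a b k m : 'M[C]_4 :=
  let d := a + m%:C%C * expi k in
  let b' := expi (2 * k) * b^* in
  mx_of_rows 4
    [:: [:: a; b; 0; 0];
        [:: b'; d; 0; 0];
        [:: 0; 0; a; expi (- (2 * theta)) * b];
        [:: 0; 0; expi (2 * theta) * b'; d]].

Lemma frameL_normal theta a b k m : frameL theta a b k m \is normalmx.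
Proof.
apply/normalmxP; rewrite /frameL; mx_simpl.
move: (expi_conjK theta) (expi_conjK k).
move: (expi theta) (expi theta)^* (expi k) (expi k)^* b (b^*) a (a^*) m%:C%C.
by move=> g gc w wc b0 bc a0 ac m0 E1 E2; congr_mx4; ring: E1 E2.
Qed.

Definition frameX2 : 'M[C]_4 :=
  2^-1 *: mx_of_rows 4 [:: [:: 1; 0; 0; 0]; [:: 0; 1; 0; 0];
                  [:: 0; 0; -1; 0]; [:: 0; 0; 0; -1]].

Definition frameX3 theta : 'M[C]_4 :=
  (Num.sqrt 2)^-1%:C%C *: mx_of_rows 4
    [:: [:: 0; 0; expi theta; 0]; [:: 0; 0; 0; expi (- theta)];
        [:: 0; 0; 0; 0]; [:: 0; 0; 0; 0]].

Lemma X2_frame phi theta :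
  X2 phi theta = Tmx phi theta *m frameX2 *m (Tmx phi theta)^t*.
Proof.
rewrite /X2 /frameX2 -scalemxAr -scalemxAl; congr (_ *: _).
have c2 : (cos (2 * theta))%:C%C = (cos theta)%:C%C ^+ 2 - (sin theta)%:C%C ^+ 2.
  by rewrite mulr_natl mulr2n cosD rmorphB !rmorphM.
have s2 : (sin (2 * theta))%:C%C = 2 * (sin theta)%:C%C * (cos theta)%:C%C.
  by rewrite mulr_natl mulr2n sinD -mulrA mulr_natl rmorphD !rmorphM mulr2n [X in _ + X]mulrC.
rewrite c2 s2 /Tmx; mx_simpl; move: (expi_conjK phi) (@sqrCi C).
move: (expi phi) (expi phi)^* (cos theta)%:C%C (sin theta)%:C%C 'i.
by move=> p q c s j E2 E3; congr_mx4; ring: E2 E3.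
Qed.

Lemma X3_frame phi theta : cos theta != 0 ->
  X3 phi theta = Tmx phi theta *m frameX3 theta *m (Tmx phi theta)^t*.
Proof.
move=> c0; rewrite /X3 /frameX3 -scalemxAr -scalemxAl rmorphM /= [X in X *: _]mulrC -scalerA.
(* The tangent enters the matrix only through this product, once the factor [cos theta] has been
   moved inside. *)
have ct : (cos theta)%:C%C * (tan theta)%:C%C = (sin theta)%:C%C.
  by rewrite -rmorphM /= /tan mulrC divfK.
congr (_ *: _); move: (tan theta) ct => t ct; rewrite /Tmx; mx_simpl.
move: ct (expi_conjK phi) (@sqrCi C).
move: (expi phi) (expi phi)^* (expi theta) (expi theta)^*.
move: t%:C%C (cos theta)%:C%C (sin theta)%:C%C 'i.
by move=> t0 c s j p q g h ct E2 E3; congr_mx4; ring: ct E2 E3.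
Qed.

(** * Commutants of [frameL] and of the Hamiltonian in the frame *)

Lemma frameX2_commute theta a b k m : commutator (frameL theta a b k m) frameX2 = 0.
Proof.
apply/eqP; rewrite subr_eq0 /frameL /frameX2; apply/eqP; mx_simpl.
by congr_mx4; ring.
Qed.

(** Up to scale, the nonzero block of [frameX3] is [diag(e^(i theta), e^(-i theta))], which
    intertwines the two blocks of [frameL]: conjugation by it produces exactly the phases
    [e^(-2i theta)] and [e^(2i theta)]. This block is unitary, so its adjoint intertwines them in
    the other direction. *)
Lemma frameX3_commute theta a b k m : commutator (frameL theta a b k m) (frameX3 theta) = 0.
Proof.
apply/eqP; rewrite subr_eq0 /frameL /frameX3; apply/eqP; mx_simpl.
move: (expi_conjK theta); move: (expi theta) (expi theta)^* => g h E.
by congr_mx4; ring: E.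
Qed.

Lemma frameX3_adj_commute theta a b k m :
  commutator (frameL theta a b k m) ((frameX3 theta)^t* ) = 0.
Proof.
apply/eqP; rewrite subr_eq0 /frameL /frameX3; apply/eqP; mx_simpl.
move: (expi_conjK theta); move: (expi theta) (expi theta)^* => g h E.
by congr_mx4; ring: E.
Qed.

Lemma frameX2_energy E0 E1 : commutator (Hamiltonian E0 E1) frameX2 = 0.
Proof.
apply/eqP; rewrite HamiltonianE subr_eq0 /frameX2; apply/eqP; mx_simpl.
by congr_mx4; ring.
Qed.

(** The nonzero entries sit at (0,2) and (1,3), and both positions have level difference
    [E0 - E1]. *)
Lemma frameX3_energy E0 E1 theta :
  commutator (Hamiltonian E0 E1) (frameX3 theta) = (E0 - E1)%:C%C *: frameX3 theta.
Proof.
apply/eqP; rewrite HamiltonianE subr_eq /frameX3 rmorphB; apply/eqP; mx_simpl.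
by congr_mx4; ring.
Qed.

Lemma frameX3_adj_energy E0 E1 theta :
  commutator (Hamiltonian E0 E1) ((frameX3 theta)^t* )
  = - (E0 - E1)%:C%C *: (frameX3 theta)^t*.
Proof.
apply/eqP; rewrite HamiltonianE subr_eq /frameX3 rmorphB; apply/eqP; mx_simpl.
by congr_mx4; ring.
Qed.

(** With [h_i] the diagonal of the Hamiltonian, [[H, Y] = z Y] says that [z - (h_i - h_j)]
    annihilates the entry [y_ij]. The differences are 0, [D], [-D], [2D], [-2D] with [D] nonzero, so
    each [z] selects one group of entries. Commutation with [frameL], whose off-diagonal entries are
    nonzero multiples of [b] or its conjugate, then relates the survivors. *)
Lemma frame_eigenvector_span theta a b k m E0 E1 (z : C) (Y : 'M[C]_4) :
  b != 0 -> E0 - E1 != 0 ->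
  commutator (frameL theta a b k m) Y = 0 ->
  commutator (Hamiltonian E0 E1) Y = z *: Y ->
  Y \in <<[:: X1 R; frameX2; frameX3 theta; (frameX3 theta)^t* ]>>%VS.
Proof.
move=> b0 dE /eqP; rewrite subr_eq0 => /eqP cM /eqP; rewrite subr_eq => /eqP cH.
pose D : C := (E0 - E1)%:C%C.
have D0 : D != 0 by rewrite fmorph_eq0.
have D2 : 2 * D != 0 by rewrite mulf_neq0 // pnatr_eq0.
have zero (c x : C) : c != 0 -> c * x = 0 -> x = 0.
  by move=> c0 /eqP; rewrite mulf_eq0 (negPf c0) => /eqP.
move: (mx_rows_of Y) cM cH; rewrite /rows_of /mkseq /=.
move: (Y (inord 0) (inord 0)) (Y (inord 0) (inord 1))
  (Y (inord 0) (inord 2)) (Y (inord 0) (inord 3)) => y00 y01 y02 y03.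
move: (Y (inord 1) (inord 0)) (Y (inord 1) (inord 1))
  (Y (inord 1) (inord 2)) (Y (inord 1) (inord 3)) => y10 y11 y12 y13.
move: (Y (inord 2) (inord 0)) (Y (inord 2) (inord 1))
  (Y (inord 2) (inord 2)) (Y (inord 2) (inord 3)) => y20 y21 y22 y23.
move: (Y (inord 3) (inord 0)) (Y (inord 3) (inord 1))
  (Y (inord 3) (inord 2)) (Y (inord 3) (inord 3)) => y30 y31 y32 y33.
move=> {Y}->; rewrite HamiltonianE /frameL expi2 -[in expi (- _)]mulrN !expi2 expiN.
have := expi_conjK theta; have := expi_neq0 theta; have := expi_neq0 k.
have bc0 : b^* != 0 by rewrite fmorph_eq0.
have h0 : (expi theta)^* != 0 by rewrite fmorph_eq0 expi_neq0.
move hE : (expi theta)^* h0 => h h0 w0 g0 gh cM cH.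
(* Extracts a wanted equation [t = 0] from an entry equation [u = v], leaving [t = v - u] to
   [ring]. *)
have lin (u v t : C) : u = v -> t = v - u -> t = 0 by move=> -> ->; rewrite subrr.
rewrite mul_mx_rows /rows_of /mkseq /= mul_mx_rows /rows_of /mkseq /= in cM.
rewrite !mul_mx_rows scale_mx_rows add_mx_rows /rows_of /mkseq /= in cH.
have M i j lti ltj := mx_of_rowsP cM (i := i) (j := j) lti ltj.
have H i j lti ltj := mx_of_rowsP cH (i := i) (j := j) lti ltj.
have {cM M} := (M 0%N 0%N isT isT, M 0%N 1%N isT isT, M 0%N 2%N isT isT,
  M 0%N 3%N isT isT, M 2%N 0%N isT isT, M 2%N 1%N isT isT, M 2%N 2%N isT isT,
  M 2%N 3%N isT isT).
have {cH H} := (H 0%N 0%N isT isT, H 0%N 1%N isT isT, H 0%N 2%N isT isT, H 0%N 3%N isT isT,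
  H 1%N 0%N isT isT, H 1%N 1%N isT isT, H 1%N 2%N isT isT, H 1%N 3%N isT isT,
  H 2%N 0%N isT isT, H 2%N 1%N isT isT, H 2%N 2%N isT isT, H 2%N 3%N isT isT,
  H 3%N 0%N isT isT, H 3%N 1%N isT isT, H 3%N 2%N isT isT, H 3%N 3%N isT isT).
rewrite /= !(mul0r, mulr0, addr0, add0r).
move=> [[[[[[[[[[[[[[[H00 H01] H02] H03] H10] H11] H12] H13] H20] H21] H22] H23] H30] H31] H32] H33].
move=> [[[[[[[M00 M01] M02] M03] M20] M21] M22] M23].
have DE : D = E0%:C%C - E1%:C%C by rewrite /D rmorphB.
have {}H00 : z * y00 = 0 by apply: (lin _ _ _ H00); ring.
have {}H11 : z * y11 = 0 by apply: (lin _ _ _ H11); ring.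
have {}H12 : z * y12 = 0 by apply: (lin _ _ _ H12); ring.
have {}H21 : z * y21 = 0 by apply: (lin _ _ _ H21); ring.
have {}H22 : z * y22 = 0 by apply: (lin _ _ _ H22); ring.
have {}H33 : z * y33 = 0 by apply: (lin _ _ _ H33); ring.
have {}H01 : (z - D) * y01 = 0 by apply: (lin _ _ _ H01); rewrite DE; ring.
have {}H02 : (z - D) * y02 = 0 by apply: (lin _ _ _ H02); rewrite DE; ring.
have {}H13 : (z - D) * y13 = 0 by apply: (lin _ _ _ H13); rewrite DE; ring.
have {}H23 : (z - D) * y23 = 0 by apply: (lin _ _ _ H23); rewrite DE; ring.
have {}H10 : (z + D) * y10 = 0 by apply: (lin _ _ _ H10); rewrite DE; ring.
have {}H20 : (z + D) * y20 = 0 by apply: (lin _ _ _ H20); rewrite DE; ring.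
have {}H31 : (z + D) * y31 = 0 by apply: (lin _ _ _ H31); rewrite DE; ring.
have {}H32 : (z + D) * y32 = 0 by apply: (lin _ _ _ H32); rewrite DE; ring.
have {}H03 : (z - 2 * D) * y03 = 0 by apply: (lin _ _ _ H03); rewrite DE; ring.
have {}H30 : (z + 2 * D) * y30 = 0 by apply: (lin _ _ _ H30); rewrite DE; ring.
(* Each of the four cases for z below leaves only the entries whose level difference is z;
   the relations M then kill them or tie them together. *)
suff [[y10_0 y12_0 y21_0 y32_0] [y01_0 y23_0 y03_0 y30_0] [y11E y33E y13E y31E]] :
    [/\ [/\ y10 = 0, y12 = 0, y21 = 0 & y32 = 0],
        [/\ y01 = 0, y23 = 0, y03 = 0 & y30 = 0]
      & [/\ y11 = y00, y33 = y22, y13 = h ^+ 2 * y02 & y31 = expi theta ^+ 2 * y20]].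
  have q0 : (Num.sqrt 2)%:C%C != 0 :> C by rewrite fmorph_eq0 gt_eqF // sqrtr_gt0 ltr0n.
  (* The sum and difference of [y00] and [y22] undo the halves in [X1] and [frameX2]; the other two
     coefficients cancel the entries [e^(i theta) / sqrt 2] at (0,2) and its conjugate at (2,0). *)
  suff -> : mx_of_rows 4
      [:: [:: y00; y01; y02; y03]; [:: y10; y11; y12; y13];
          [:: y20; y21; y22; y23]; [:: y30; y31; y32; y33]]
    = (y00 + y22) *: X1 R + (y00 - y22) *: frameX2
      + ((Num.sqrt 2)%:C%C * h * y02) *: frameX3 theta
      + ((Num.sqrt 2)%:C%C * expi theta * y20) *: (frameX3 theta)^t*.
    exact: memv_span4.
  rewrite y10_0 y12_0 y21_0 y32_0 y01_0 y23_0 y03_0 y30_0 y11E y33E y13E y31E.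
  rewrite /X1 /frameX2 /frameX3 scalar_mx_rows; mx_simpl; rewrite hE.
  move: gh (divff q0); move: (_%:C%C^-1) => r gh r2.
  by congr_mx4; first [ring: r2 gh | field].
(* Besides [b], these are the off-diagonal entries of [frameL], to be divided out of the relations
   M. *)
have B2 : expi k ^+ 2 * b^* != 0 by rewrite mulf_neq0 // expf_neq0.
have B3 : h ^+ 2 * b != 0 by rewrite mulf_neq0 // expf_neq0.
have B4 : expi theta ^+ 2 * (expi k ^+ 2 * b^*) != 0 by rewrite mulf_neq0 // expf_neq0.
have ND : - D != 0 by rewrite oppr_eq0.
have N2D : - (2 * D) != 0 by rewrite oppr_eq0.
have D3 : - (3 * D) != 0 by rewrite oppr_eq0 mulf_neq0 // pnatr_eq0.
have D3' : 3 * D != 0 by rewrite mulf_neq0 // pnatr_eq0.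
have [zE|z0] := eqVneq z 0.
  move: H01 H02 H13 H23 H10 H20 H31 H32 H03 H30; rewrite zE !sub0r !add0r.
  do 4!move/(zero _ _ ND) => ?; do 4!move/(zero _ _ D0) => ?.
  move/(zero _ _ N2D) => ?; move/(zero _ _ D2) => ?; subst.
  split; split=> //.
  - by apply: (zero _ _ b0); apply: (lin _ _ _ (esym M02)); ring.
  - by apply: (zero _ _ B2); apply: (lin _ _ _ M20); ring.
  - by apply/eqP; rewrite -subr_eq0; apply/eqP/(zero _ _ b0)/(lin _ _ _ (esym M01)); ring.
  - by apply/eqP; rewrite -subr_eq0; apply/eqP/(zero _ _ B3)/(lin _ _ _ (esym M23)); ring.
  - by rewrite mulr0.
  - by rewrite mulr0.
(* From here on [z] is nonzero, so the entries between levels of equal energy vanish. *)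
move: H00 H11 H12 H21 H22 H33; do 6!move/(zero _ _ z0) => ?; subst.
have [zE|zD] := eqVneq z D.
  have zD : z + D = 2 * D by rewrite zE; ring.
  move: H10 H20 H31 H32 H03 H30; rewrite zD zE.
  do 4!move/(zero _ _ D2) => ?; subst.
  have -> : D - 2 * D = - D by ring.
  have -> : D + 2 * D = 3 * D by ring.
  move/(zero _ _ ND) => ?; move/(zero _ _ D3') => ?; subst.
  split; split=> //.
  - by apply: (zero _ _ B2); apply: (lin _ _ _ M00); ring.
  - by apply: (zero _ _ B4); apply: (lin _ _ _ M22); ring.
  - by apply/eqP; rewrite -subr_eq0; apply/eqP/(zero _ _ b0)/(lin _ _ _ (esym M03)); ring.
  - by rewrite mulr0.
have zD' : z - D != 0 by rewrite subr_eq0.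
move: H01 H02 H13 H23; do 4!move/(zero _ _ zD') => ?; subst.
have [zE|zND] := eqVneq z (- D).
  move: H03 H30; rewrite zE.
  have -> : - D - 2 * D = - (3 * D) by ring.
  have -> : - D + 2 * D = D by ring.
  move/(zero _ _ D3) => ?; move/(zero _ _ D0) => ?; subst.
  split; split=> //.
  - by apply: (zero _ _ b0); apply: (lin _ _ _ (esym M00)); ring.
  - by apply: (zero _ _ B3); apply: (lin _ _ _ (esym M22)); ring.
  - by rewrite mulr0.
  - apply/eqP; rewrite -subr_eq0; apply/eqP/(zero _ _ B3)/(lin _ _ _ (esym M21)).
    by ring: gh.
have zD2 : z + D != 0 by rewrite addr_eq0.
(* Only the corners [y03] and [y30], of level difference [2D] and [-2D], are left; [M02] and [M20]
   kill them whatever [z] is. *)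
move: H10 H20 H31 H32; do 4!move/(zero _ _ zD2) => ?; subst.
split; split=> //.
- by apply: (zero _ _ B4); apply: (lin _ _ _ M02); ring.
- by apply: (zero _ _ B3); apply: (lin _ _ _ (esym M20)); ring.
- by rewrite mulr0.
- by rewrite mulr0.
Qed.

Lemma frame_orthonormal theta
    (X := [:: X1 R; frameX2; frameX3 theta; (frameX3 theta)^t* ]) (i j : 'I_4) :
  hsdot X`_i X`_j = (i == j)%:R.
Proof.
have r2 : (Num.sqrt 2)%:C%C ^+ 2 = 2 :> C.
  by rewrite -rmorphXn /= sqr_sqrtr ?ler0n // rmorph_nat.
have q0 : (Num.sqrt 2)%:C%C != 0 :> C by rewrite fmorph_eq0 gt_eqF // sqrtr_gt0 ltr0n.
have {q0} rr : (Num.sqrt 2)%:C%C^-1 ^+ 2 = 2^-1 :> C by rewrite exprVn r2.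
have half : 2^-1 + 2^-1 = 1 :> C by field.
rewrite {}/X /X1 /frameX2 /frameX3 scalar_mx_rows.
case: i j => [[|[|[|[|//]]]] ?] [[|[|[|[|//]]]] ?]; rewrite /hsdot /=; mx_simpl.
all: rewrite trace_mx_rows /= ?expiN ?conjCK.
all: move: (expi_conjK theta); move: (expi theta) (expi theta)^* => g h gh.
all: rewrite ?rmorph1; try by field.
(* The goals left are the squared norms of [frameX3] and its adjoint, each a sum of two squared
   moduli equal to one half. *)
all: move: rr half; move: (_%:C%C^-1) (2^-1 : C) => r t rr half.
all: by transitivity (t + t); [ring: rr gh | exact: half].
Qed.
End TwoQubitModel.

(** * Transport from the frame back to the original basis *)

Local Open Scope sesquilinear_scope.
Local Open Scope complex_scope.

Theorem mainTheorem8 (R : realType) (E0 E1 phi theta k m : R) (a b : R[i])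
    (hE : E0 - E1 != 0)
    (hphi : 0 <= phi < 2 * pi)
    (htheta : - (pi / 2) < theta < 0 \/ 0 < theta < pi / 2)
    (hb : b != 0) :
  let G := generator (Hamiltonian E0 E1) (Lmx phi theta a b k m) in
  let X := [:: X1 R; X2 phi theta; X3 phi theta; X4 phi theta] in
  [/\ \dim (attractor_space G) = 4%N,
      basis_of (attractor_space G) X,
      (forall i j : 'I_4, hsdot X`_i X`_j = (i == j)%:R)
    & [/\ eigenvector_of G 0 (X1 R),
          eigenvector_of G 0 (X2 phi theta),
          eigenvector_of G (- 'i%R * (E0 - E1)%:C) (X3 phi theta)
        & eigenvector_of G ('i%R * (E0 - E1)%:C) (X4 phi theta)]].
Proof.
have c0 : cos theta != 0.
  have p0 : 0 < pi / 2 :> R by rewrite divr_gt0 ?pi_gt0.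
  rewrite gt_eqF // cos_gt0_pihalf //.
  case: htheta => /andP[lo hi]; rewrite ?lo ?hi ?andbT.
    exact: lt_trans p0.
  by rewrite (lt_trans _ lo) ?oppr_lt0.
move=> G X; pose T := Tmx phi theta.
have TT : T^t* *m T = 1%:M := Tmx_unitary phi theta.
have TH : T *m Hamiltonian E0 E1 *m T^t* = Hamiltonian E0 E1 := Tmx_Hamiltonian E0 E1 phi theta.
pose Y := [:: X1 R; frameX2 R; frameX3 theta; (frameX3 theta)^t* ].
have nL := frameL_normal theta a b k m.
have X1E : X1 R = T *m X1 R *m T^t*.
  by rewrite /X1 -scalemxAr -scalemxAl mulmx1 (mulmx1C TT).
have XE : X = [seq T *m Z *m T^t* | Z <- Y].
  rewrite /X /X4 X2_frame (X3_frame phi c0) /= !adjmxM trmxCK !mulmxA.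
  by rewrite -/T; congr (_ :: _).
have oX (i j : 'I_4) : hsdot X`_i X`_j = (i == j)%:R.
  by rewrite XE !(nth_map 0) // hsdot_unitary // frame_orthonormal.
have X0 (i : 'I_4) : X`_i != 0.
  apply/eqP => e0; have /eqP := oX i i.
  by rewrite e0 /hsdot mulmx0 mxtrace0 eqxx eq_sym oner_eq0.
(* A level difference [w] in the frame becomes the eigenvalue [- 'i * w] of the generator. *)
have eX i w : (i < 4)%N -> commutator (frameL theta a b k m) Y`_i = 0 ->
    commutator (Hamiltonian E0 E1) Y`_i = w *: Y`_i ->
    eigenvector_of G (- 'i * w) X`_i.
  move=> lti cL cH; split; first exact: (X0 (Ordinal lti)).
  by rewrite XE (nth_map 0) //; apply: unitary_frame_eigenvector.
have eig1 : eigenvector_of G 0 (X1 R).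
  rewrite -(mulr0 (- 'i)); apply: (eX 0%N) => //=.
    by rewrite /commutator /X1 -scalemxAr -scalemxAl mulmx1 mul1mx subrr.
  by rewrite /commutator /X1 -scalemxAr -scalemxAl mulmx1 mul1mx subrr scale0r.
have eig2 : eigenvector_of G 0 (X2 phi theta).
  rewrite -(mulr0 (- 'i)); apply: (eX 1%N) => //=; first exact: frameX2_commute.
  by rewrite scale0r frameX2_energy.
have eig3 : eigenvector_of G (- 'i * (E0 - E1)%:C) (X3 phi theta).
  by apply: (eX 2%N) => //=; [exact: frameX3_commute | exact: frameX3_energy].
have eig4 : eigenvector_of G ('i * (E0 - E1)%:C) (X4 phi theta).
  (* Taking the adjoint reverses the level difference to [- (E0 - E1)], hence the opposite sign. *)
  rewrite -['i * _]opprK -mulrN -mulNr; apply: (eX 3%N) => //=.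
    exact: frameX3_adj_commute.
  exact: frameX3_adj_energy.
have fX : free X by apply: hsdot_free.
have Re_iD (D : R) : 'Re ('i * D%:C) = 0.
  by rewrite ReE rmorphM /= conjCi conjC_realC mulNr subrr mul0r.
have bX : basis_of (attractor_space G) X.
  apply/andP; split=> //; rewrite eqEsubv; apply/andP; split.
    (* The span lies in the attractor space because all four eigenvalues have real part 0. *)
    apply/span_subvP => Z; rewrite !inE => /or4P[]/eqP ->.
    - exact: memv_attractor (raddf0 _) eig1.2.
    - exact: memv_attractor (raddf0 _) eig2.2.
    - by apply: memv_attractor eig3.2; rewrite mulNr raddfN /= Re_iD oppr0.
    - exact: memv_attractor eig4.2.
  (* Conversely, each eigenvector for an imaginary eigenvalue is pulled back to the frame, placed in
     the span of [Y] there, and carried back by [T]. *)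
  apply: attractor_subv => w Z rw eZ.
  have [Z0 [-> cL cH]] := unitary_frame_commutator TT TH (Hamiltonian_hermitian E0 E1) nL rw eZ.
  by rewrite XE; apply: mulmx_span; apply: frame_eigenvector_span cL cH.
split=> //.
by rewrite -(span_basis bX) (eqnP fX).
Qed.
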